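(* For each $\epsilon \in (0,1)$, let $t_{\epsilon}:[0,1]\to\mathbb{R}$ be a function with $t_{\epsilon}(0)=\epsilon$ satisfying the differential equation \[t'_{\epsilon}(x)= \log t_{\epsilon}(x)\, \frac{t_{\epsilon}(x)\,(1 - t_{\epsilon}(x))}{x - (1+x)\, t_{\epsilon}(x)}.\] Let $L = \lim_{\epsilon \to 0} t_{\epsilon}(1)$ and let $C = (L(1-L))^{-1/2}$. Then \[c_t \geq C^{-(1+o(1))t^2},\] where $o(1)$ denotes a quantity tending to $0$ as $t\to\infty$.
   Context: For a graph $G$, $k_t(G)$ denotes the number of complete subgraphs on $t$ vertices in $G$, and $\overline{G}$ is the complement of $G$. Let $k_t(n) = \min\{k_t(G) + k_t(\overline{G}) : |G| = n\}$, i.e. the minimum number of monochromatic copies of $K_t$ in a two-colouring of the edges of $K_n$. The Ramsey multiplicity constant is $c_t = \lim_{n\to\infty} k_t(n)/\binom{n}{t}$ (this limit exists since the ratios $k_t(n)/\binom{n}{t}$ are nondecreasing in $n$ and bounded by $1$). Here $\log$ is the natural logarithm. *)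

(* Defs.v *)
From HB Require Import structures.
From mathcomp Require Export all_boot all_order all_algebra.
From mathcomp Require Export all_classical all_reals all_analysis.

Set Implicit Arguments.
Unset Strict Implicit.
Unset Printing Implicit Defensive.

Export Order.TTheory GRing.Theory Num.Theory.
Export numFieldNormedType.Exports.

(* A finite simple graph with vertex type T is given by its edge set. *)
Definition simple_graph (T : finType) (E : {set {set T}}) : bool :=
  [forall e in E, #|e| == 2].

Definition graph_compl (T : finType) (E : {set {set T}}) : {set {set T}} :=
  [set e : {set T} | (#|e| == 2) && (e \notin E)].

Definition is_clique (T : finType) (E : {set {set T}}) (A : {set T}) : bool :=
  [forall x in A, forall y in A, (x != y) ==> ([set x; y]%SET \in E)].

Definition num_cliques (T : finType) (t : nat) (E : {set {set T}}) : nat :=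
  #|[set A : {set T} | (#|A| == t) && is_clique E A]|.

Definition mono_cliques (T : finType) (t : nat) (E : {set {set T}}) : nat :=
  (num_cliques t E + num_cliques t (graph_compl E))%N.

(* The minimum of k_t(G) + k_t(complement of G) over the graphs G on n
   vertices; the empty graph witnesses that the range is nonempty. *)
Definition min_mono_cliques (t n : nat) : nat :=
  mono_cliques t
    [arg min_(E < (finset.set0 : {set {set 'I_n}}) | simple_graph E)
       mono_cliques t E]%N.

Lemma simple_graph_set0 (T : finType) :
  simple_graph (finset.set0 : {set {set T}}).
Proof. by apply/forall_inP => e; rewrite finset.inE. Qed.

Lemma min_mono_cliques_le (t n : nat) (E : {set {set 'I_n}}) :
  simple_graph E -> (min_mono_cliques t n <= mono_cliques t E)%N.
Proof.
rewrite /min_mono_cliques; case: arg_minnP; first exact: simple_graph_set0.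
by move=> F _ Fmin /Fmin.
Qed.

Lemma min_mono_cliques_ex (t n : nat) : exists E : {set {set 'I_n}},
  simple_graph E /\ mono_cliques t E = min_mono_cliques t n.
Proof.
rewrite /min_mono_cliques; case: arg_minnP; first exact: simple_graph_set0.
by move=> F sF _; exists F.
Qed.

Local Open Scope classical_set_scope.
Local Open Scope ring_scope.

Definition ramsey_mult_const (R : realType) (t : nat) : R :=
  lim ((min_mono_cliques t n)%:R / 'C(n, t)%:R @[n --> \oo] : set_system R).

(* Derivative of f at x relative to A: only the values of f on A matter, and
   at an endpoint of an interval A this is the one-sided derivative. *)
Definition has_deriv_within (R : realType) (A : set R) (f : R -> R) (x l : R)
  : Prop :=
  (f y - f x) / (y - x) @[y --> within A x^'] --> l.

(* y' = log y * y (1 - y) / (x - (1 + x) y) on [0, 1].  Both ln and division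
   are total, so the requirement that the right-hand side is defined
   (y > 0 and nonzero denominator) is explicit. *)
Definition solves_ode (R : realType) (y : R -> R) : Prop :=
  forall x : R, 0 <= x <= 1 ->
    [/\ 0 < y x,
        x - (1 + x) * y x != 0 &
        has_deriv_within `[0, 1] y x
          (ln (y x) * (y x * (1 - y x) / (x - (1 + x) * y x)))].

(* Main.v *)
(* Call the two colour classes red and blue.  Following the neighbourhood proof
   of Ramsey's theorem, but keeping every vertex, a set of [n] vertices contains
   at least [M i j * n ^ i / i!] red [K_i] or [M i j * n ^ j / j!] blue [K_j]
   as soon as [M i j] is at most [M (i-1) j * p ^ m / 2] and
   [M i (j-1) * q ^ m / 2], where [m = max i j] and [p + q < 1].  Writing
   [M = exp (- F)], this asks for a function [F] with
   [exp (- F_x / m) + exp (- F_y / m) <= 1].  The homogeneous solutions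
   [F = x ^ 2 * f (y / x)] on [y <= x] have [F_x = - x ln (1 - tau (y / x))] and
   [F_y = - x ln (tau (y / x))]; the integrability condition is exactly the
   differential equation of the theorem.  As [tau] increases, [f] is concave, so
   discretisation costs nothing, and [F t t = t ^ 2 * f 1] with
   [f 1 = - ln (L (1 - L)) / 2].  Reflected in the diagonal, [F] has a convex
   kink there, which averaging removes because the set of admissible gradients
   is convex.

   The limit in [eps] exists because the right-hand side of the equation is
   decreasing in the unknown, so that solutions stay ordered. *)

Require Import Defs.
From mathcomp Require Import ring lra zify.
Set Implicit Arguments.
Unset Strict Implicit.
Unset Printing Implicit Defensive.


(** * Cliques inside a vertex set and inside neighbourhoods *)

Definition cliques_in (T : finType) (E : {set {set T}}) (A : {set T}) (i : nat)
  : {set {set T}} :=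
  [set B : {set T} | [&& B \subset A, #|B| == i & is_clique E B]]%SET.

Definition nbhd_in (T : finType) (E : {set {set T}}) (A : {set T}) (v : T)
  : {set T} :=
  [set u in A | (u != v) && ([set v; u]%SET \in E)]%SET.

Lemma num_cliquesE (T : finType) (E : {set {set T}}) (i : nat) :
  num_cliques i E = #|cliques_in E finset.setT i|.
Proof.
by apply: eq_card => B; rewrite !finset.inE finset.subsetT.
Qed.

Lemma cliques_inS (T : finType) (E : {set {set T}}) (A B : {set T}) (i : nat) :
  A \subset B -> (#|cliques_in E A i| <= #|cliques_in E B i|)%N.
Proof.
move=> AB; apply/subset_leq_card/fintype.subsetP => C; rewrite !finset.inE.
by move=> /and3P[CA -> ->]; rewrite (fintype.subset_trans CA AB).
Qed.

Lemma nbhd_in_sub (T : finType) (E : {set {set T}}) (A : {set T}) (v : T) :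
  nbhd_in E A v \subset A.
Proof. by apply/fintype.subsetP => u; rewrite finset.inE => /andP[]. Qed.

Lemma cliques_in0 (T : finType) (E : {set {set T}}) (A : {set T}) :
  #|cliques_in E A 0| = 1%N.
Proof.
apply/eqP/cards1P; exists finset.set0; apply/finset.setP => B; rewrite !finset.inE.
rewrite cards_eq0; apply/and3P/eqP => [[_ /eqP //]|->].
split; rewrite ?finset.sub0set ?cards0 //.
by rewrite /is_clique; apply/forall_inP => x; rewrite finset.inE.
Qed.

(** Asking only that the two edge sets cover all pairs keeps the colours interchangeable; the
    successor accounts for [v] itself. *)
Lemma card_nbhd_in (T : finType) (E E' : {set {set T}}) (A : {set T}) (v : T) :
  (forall x y : T, x != y ->
     ([set x; y]%SET \in E) || ([set x; y]%SET \in E')) ->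
  (#|A| <= (#|nbhd_in E A v| + #|nbhd_in E' A v|).+1)%N.
Proof.
move=> EE'; have sub : A \subset
    (v |: (nbhd_in E A v :|: nbhd_in E' A v))%SET.
  apply/fintype.subsetP => u uA; rewrite !finset.inE uA.
  case: (eqVneq u v) => //= uv; apply: EE'; by rewrite eq_sym.
apply: (leq_trans (subset_leq_card sub)).
rewrite cardsU1; apply: (leq_trans (leq_add (leq_b1 _) (leqnn _))).
by rewrite add1n ltnS cardsU leq_subr.
Qed.

(** Adding [v] to a clique of its neighbourhood gives a clique through [v], and is injective because
    [v] lies outside its own neighbourhood. *)
Lemma card_cliques_through (T : finType) (E : {set {set T}}) (A : {set T})
    (i : nat) (v : T) : v \in A ->
  (#|cliques_in E (nbhd_in E A v) i| <=
   #|[set C in cliques_in E A i.+1 | v \in C]%SET|)%N.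
Proof.
move=> vA; set S := cliques_in _ _ i.
have vS B : B \in S -> v \notin B.
  rewrite finset.inE => /and3P[/fintype.subsetP BN _ _]; apply/negP => /BN.
  by rewrite finset.inE eqxx andbF.
have inj : {in S &, injective (fun B : {set T} => v |: B)%SET}.
  move=> B C /vS vB /vS vC BC.
  by rewrite -(finset.setU1K vB) BC finset.setU1K.
rewrite -(card_in_imset inj); apply/subset_leq_card/fintype.subsetP => C.
case/imsetP => B BS ->; have vB := vS _ BS.
move: BS; rewrite !finset.inE eqxx /= andbT => /and3P[BN /eqP cB clB].
apply/and3P; split.
- rewrite finset.subUset finset.sub1set vA; apply: (fintype.subset_trans BN).
  exact: nbhd_in_sub.
- by rewrite cardsU1 vB cB.
- have vE u : u \in B -> [set v; u]%SET \in E.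
    by move/(fintype.subsetP BN); rewrite finset.inE => /and3P[].
  rewrite /is_clique; apply/forall_inP => x; rewrite !finset.inE => /orP[/eqP->|xB];
  apply/forall_inP => y; rewrite !finset.inE => /orP[/eqP->|yB];
  apply/implyP => xy.
  + by rewrite eqxx in xy.
  + exact: vE.
  + by rewrite finset.setUC; exact: vE.
  + by move/forall_inP/(_ _ xB)/forall_inP/(_ _ yB)/implyP/(_ xy): clB.
Qed.

(** Double counting of pairs [(v, C)] with [v] in [C]: a clique on [i.+1] vertices is met at most
    [i.+1] times. *)
Lemma sum_cliques_nbhd (T : finType) (E : {set {set T}}) (A : {set T})
    (i : nat) :
  (\sum_(v in A) #|cliques_in E (nbhd_in E A v) i| <=
   i.+1 * #|cliques_in E A i.+1|)%N.
Proof.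
apply: (@leq_trans (\sum_(v in A)
          #|[set C in cliques_in E A i.+1 | v \in C]%SET|)%N).
  by apply: leq_sum => v vA; exact: card_cliques_through.
under eq_bigr do rewrite -sum1dep_card big_mkcondr /=.
rewrite exchange_big /= mulnC -sum_nat_const.
apply: leq_sum => C; rewrite finset.inE => /and3P[CA /eqP cC _].
rewrite -big_mkcondr /= sum1dep_card -cC; apply: subset_leq_card.
by apply/fintype.subsetP => x; rewrite !finset.inE => /andP[].
Qed.

(** * The Ramsey recursion for clique densities *)

Section DenseCliques.
Local Open Scope ring_scope.
Variable R : realType.

Lemma many_rich_nbhds (T : finType) (E : {set {set T}}) (A S : {set T})
    (i : nat) (a : R) :
  S \subset A -> 0 <= a -> #|A|%:R / 2 <= #|S|%:R :> R ->
  (forall v, v \in S -> a <= #|cliques_in E (nbhd_in E A v) i|%:R) ->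
  a * #|A|%:R / 2 / i.+1%:R <= #|cliques_in E A i.+1|%:R.
Proof.
move=> SA a0 AS rich; rewrite ler_pdivrMr ?ltr0n// -natrM mulnC.
rewrite -mulrA; apply: (le_trans (ler_wpM2l a0 AS)).
rewrite mulr_natr -sumr_const; apply: (le_trans (ler_sum _ rich)).
rewrite -natr_sum ler_nat (leq_trans _ (sum_cliques_nbhd E A i))//.
rewrite [leqRHS](bigID (mem S)) /=.
rewrite [X in (_ <= X + _)%N](eq_bigl (fun v => v \in S)) ?leq_addr// => v.
by rewrite andb_idl// => /(fintype.subsetP SA).
Qed.

(** Either one neighbourhood already holds the [E']-cliques wanted in [A], or every vertex of [S]
    sees many [E]-cliques and double counting gains one vertex. The factor [2^-1] is the share of
    [A] that [S] covers. *)
Lemma clique_density_step (T : finType) (E E' : {set {set T}}) (A S : {set T})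
    (i j m : nat) (p c c' : R) :
  S \subset A -> 0 < p < 1 -> 0 < c -> (i <= m)%N -> (j <= m)%N ->
  c' <= 2^-1 * c * p ^+ m ->
  (forall v, v \in S -> p * #|A|%:R <= #|nbhd_in E A v|%:R) ->
  (forall v, v \in S -> let B := nbhd_in E A v in
     c * #|B|%:R ^+ i / i`!%:R <= #|cliques_in E B i|%:R \/
     c * #|B|%:R ^+ j / j`!%:R <= #|cliques_in E' B j|%:R) ->
  #|A|%:R / 2 <= #|S|%:R :> R ->
  c' * #|A|%:R ^+ i.+1 / i.+1`!%:R <= #|cliques_in E A i.+1|%:R \/
  c' * #|A|%:R ^+ j / j`!%:R <= #|cliques_in E' A j|%:R.
Proof.
move=> SA /andP[p0 p1] c0 im jm cc' Sp SK AS.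
set x : R := #|A|%:R; have x0 : 0 <= x by rewrite ler0n.
have [H|H] := leP (c' * x ^+ j / j`!%:R) (#|cliques_in E' A j|%:R : R).
  by right.
(* Since [p < 1] and [k <= m], the single power [p ^+ m] serves both exponents [i] and [j]. *)
left; have pw k : (k <= m)%N -> c' * x ^+ k <= 2^-1 * (c * (p * x) ^+ k).
  move=> km; rewrite exprMn !mulrA ler_wpM2r ?exprn_ge0//.
  apply: (le_trans cc'); rewrite ler_wpM2l ?mulr_ge0 ?invr_ge0 ?(ltW c0)//.
  by rewrite ler_wiXn2l// ltW.
have big v k : v \in S -> c * (p * x) ^+ k <= c * #|nbhd_in E A v|%:R ^+ k.
  move=> vS; rewrite ler_wpM2l ?(ltW c0)// lerXn2r ?nnegrE ?mulr_ge0 ?(ltW p0)//.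
  exact: Sp.
have rich v : v \in S ->
    c * (p * x) ^+ i / i`!%:R <= #|cliques_in E (nbhd_in E A v) i|%:R.
  move=> vS; case: (SK v vS) => /= Kv.
    by apply: le_trans Kv; rewrite ler_wpM2r ?invr_ge0// big.
  exfalso; move: H; rewrite ltNge => /negP; apply.
  apply: (@le_trans _ _ (#|cliques_in E' (nbhd_in E A v) j|%:R)); last first.
    by rewrite ler_nat; exact/cliques_inS/nbhd_in_sub.
  apply: le_trans Kv; rewrite ler_wpM2r ?invr_ge0//.
  apply: (le_trans (pw j jm)); apply: (@le_trans _ _ (c * (p * x) ^+ j)).
    by rewrite ler_piMl ?invf_le1 ?mulr_ge0 ?exprn_ge0 ?mulr_ge0 ?(ltW c0) ?(ltW p0)// ler1n.
  exact: big.
have a0 : 0 <= c * (p * x) ^+ i / i`!%:R.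
  by rewrite !mulr_ge0 ?invr_ge0 ?exprn_ge0 ?mulr_ge0 ?(ltW c0) ?(ltW p0).
apply: le_trans (many_rich_nbhds SA a0 AS rich).
rewrite factS natrM invfM exprS.
have := pw i im; set u := c' * x ^+ i; set w := c * _ => uw.
have -> : c' * (x * x ^+ i) * (i.+1%:R^-1 / i`!%:R) =
  u * (x * (i.+1%:R^-1 / i`!%:R)) by rewrite /u; ring.
have -> : w / i`!%:R * x / 2 / i.+1%:R =
  (2^-1 * w) * (x * (i.+1%:R^-1 / i`!%:R)) by ring.
by rewrite ler_wpM2r// !mulr_ge0 ?invr_ge0.
Qed.

(** Double induction: once [A] is large, each of its vertices has [p * #|A|] neighbours in one
    colour or [q * #|A|] in the other, and one of the two cases holds for half of [A]. The base
    cases use the empty clique and [M <= 1]. *)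
Lemma ramsey_density (M : nat -> nat -> R) :
  (forall i j, 0 < M i j <= 1) ->
  (forall i j, exists p q : R, [/\ 0 < p, 0 < q, p + q < 1,
     M i.+1 j.+1 <= 2^-1 * M i j.+1 * p ^+ (maxn i j).+1 &
     M i.+1 j.+1 <= 2^-1 * M i.+1 j * q ^+ (maxn i j).+1]) ->
  forall i j, exists N : nat, forall (T : finType) (E E' : {set {set T}})
    (A : {set T}),
    (forall x y : T, x != y ->
       ([set x; y]%SET \in E) || ([set x; y]%SET \in E')) ->
    (N <= #|A|)%N ->
    M i j * #|A|%:R ^+ i / i`!%:R <= #|cliques_in E A i|%:R \/
    M i j * #|A|%:R ^+ j / j`!%:R <= #|cliques_in E' A j|%:R.
Proof.
move=> M01 Mpq; elim=> [|i IHi] j.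
  exists 0%N => T E E' A _ _; left; rewrite cliques_in0 expr0 fact0 divr1 mulr1.
  by have /andP[] := M01 0%N j.
elim: j => [|j IHj].
  exists 0%N => T E E' A _ _; right; rewrite cliques_in0 expr0 fact0 divr1 mulr1.
  by have /andP[] := M01 i.+1 0%N.
have [N1 HN1] := IHi j.+1; have [N2 HN2] := IHj.
have [p [q [p0 q0 pq Mp Mq]]] := Mpq i j.
(* The first two terms make the chosen neighbourhoods large enough for the induction hypotheses; the
   third gives [(1 - p - q) * #|A| >= 1], which pays for the vertex itself. *)
pose N := (Num.truncn (N1%:R / p) + Num.truncn (N2%:R / q)
  + Num.truncn (1 - p - q)^-1).+1.
exists N => T E E' A EE' NA; set x : R := #|A|%:R.
have r0 : 0 < 1 - p - q by lra.
have truncx (z : R) : (Num.truncn z < N)%N -> z <= x.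
  move=> zN; apply: (@le_trans _ _ (Num.truncn z).+1%:R).
    by apply/ltW/truncnS_gt.
  by rewrite ler_nat; exact: leq_trans zN NA.
have xp : N1%:R <= p * x.
  by rewrite mulrC -ler_pdivrMr//; apply: truncx; rewrite ltnS -addnA leq_addr.
have xq : N2%:R <= q * x.
  rewrite mulrC -ler_pdivrMr//; apply: truncx.
  by rewrite ltnS addnAC leq_addl.
have xr : 1 <= (1 - p - q) * x.
  by rewrite mulrC -ler_pdivrMr// mul1r; apply: truncx; rewrite ltnS leq_addl.
pose S := [set v in A | p * x <= #|nbhd_in E A v|%:R]%SET.
have SA : S \subset A by apply/fintype.subsetP => v; rewrite finset.inE => /andP[].
have M0 k l : 0 < M k l by have /andP[] := M01 k l.
have [hS|hS] := leP (x / 2) (#|S|%:R : R).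
  apply: (@clique_density_step T E E' A S i j.+1 (maxn i j).+1 p (M i j.+1)) => //.
  - by rewrite p0; lra.
  - by rewrite leqW// leq_maxl.
  - by rewrite ltnS leq_maxr.
  - by move=> v; rewrite finset.inE => /andP[].
  - move=> v; rewrite finset.inE => /andP[_ vp]; apply: HN1 => //.
    by rewrite -(ler_nat R); exact: le_trans vp.
have E'E (u v : T) : u != v ->
    ([set u; v]%SET \in E') || ([set u; v]%SET \in E).
  by move=> /EE'; rewrite orbC.
have hS' : x / 2 <= #|(A :\: S)%SET|%:R.
  have := cardsD A S; rewrite (finset.setIidPr SA) => ->.
  by rewrite natrB ?subset_leq_card//; rewrite -/x; lra.
have S'q v : v \in (A :\: S)%SET -> q * x <= #|nbhd_in E' A v|%:R.
  rewrite !finset.inE => /andP[vS vA]; move: vS; rewrite vA /= -ltNge => vp.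
  have := card_nbhd_in A v EE'; rewrite -(ler_nat R) -natr1 natrD -/x; lra.
have := @clique_density_step T E' E A (A :\: S)%SET j i.+1 (maxn i j).+1 q
  (M i.+1 j) (M i.+1 j.+1).
case=> //.
- exact: finset.subsetDl.
- by rewrite q0; lra.
- by rewrite leqW// leq_maxr.
- by rewrite ltnS leq_maxl.
- move=> v /S'q vq; apply/or_comm; apply: HN2 => //.
  by rewrite -(ler_nat R); exact: le_trans vq.
- by right.
- by left.
Qed.

End DenseCliques.

(** * Vertex deletion and averaging *)

Section VertexDeletion.
Variable n : nat.
Implicit Type E : {set {set 'I_n.+1}}.

Definition delete_vertex (v : 'I_n.+1) E : {set {set 'I_n}} :=
  [set e : {set 'I_n} | (finset.imset (lift v) (mem e)) \in E]%SET.

Lemma delete_vertex_simple v E :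
  simple_graph E -> simple_graph (delete_vertex v E).
Proof.
move=> /forall_inP sE; apply/forall_inP => e; rewrite finset.inE => /sE.
by rewrite card_imset//; exact: lift_inj.
Qed.

Lemma delete_vertex_compl v E :
  graph_compl (delete_vertex v E) = delete_vertex v (graph_compl E).
Proof.
by apply/finset.setP => e; rewrite !finset.inE card_imset//; exact: lift_inj.
Qed.

Lemma num_cliques_delete_vertex v E t :
  (num_cliques t (delete_vertex v E) <=
   #|[set B : {set 'I_n.+1} |
       ((#|B| == t) && is_clique E B) && (v \notin B)]%SET|)%N.
Proof.
rewrite /num_cliques -(card_imset _ (imset_inj (@lift_inj _ v))).
apply/subset_leq_card/fintype.subsetP => C /imsetP[B + ->].
rewrite !finset.inE card_imset; last exact: lift_inj.
move=> /andP[-> /= clB]; apply/andP; split; last first.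
  by apply/imsetP => -[u _ /eqP]; rewrite (negPf (neq_lift _ _)).
rewrite /is_clique; apply/forall_inP => _ /imsetP[x xB ->].
apply/forall_inP => _ /imsetP[y yB ->]; apply/implyP => xy.
move/forall_inP/(_ _ xB)/forall_inP/(_ _ yB)/implyP: clB.
rewrite finset.inE imsetU1 imset_set1; apply.
by apply: contra_neq xy => ->.
Qed.

(** A clique on [t] vertices survives only the deletion of one of the [n.+1 - t] vertices outside
    it. *)
Lemma sum_num_cliques_delete_vertex E t :
  (\sum_v num_cliques t (delete_vertex v E) <= (n.+1 - t) * num_cliques t E)%N.
Proof.
apply: (@leq_trans (\sum_v #|[set B : {set 'I_n.+1} |
       ((#|B| == t) && is_clique E B) && (v \notin B)]%SET|)%N).
  by apply: leq_sum => v _; exact: num_cliques_delete_vertex.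
under eq_bigr do rewrite -sum1dep_card big_mkcondr /=.
rewrite exchange_big /= mulnC -sum_nat_const; under [leqRHS]eq_bigl do
  rewrite finset.inE.
apply: leq_sum => B /andP[/eqP cB _].
rewrite -big_mkcond /= sum1dep_card -cB; have cBC := cardsC B; rewrite card_ord in cBC.
have -> : (n.+1 - #|B|)%N = #|(~: B)%SET| by lia.
by apply: subset_leq_card; apply/fintype.subsetP => u; rewrite !finset.inE.
Qed.

Lemma min_mono_cliques_step t :
  (n.+1 * min_mono_cliques t n <= (n.+1 - t) * min_mono_cliques t n.+1)%N.
Proof.
have [E [sE <-]] := min_mono_cliques_ex t n.+1.
rewrite -[X in (X * _ <= _)%N]card_ord -sum_nat_const mulnDr.
apply: (@leq_trans (\sum_v (num_cliques t (delete_vertex v E) +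
   num_cliques t (delete_vertex v (graph_compl E))))%N).
  apply: leq_sum => v _.
  have := min_mono_cliques_le t (delete_vertex_simple v sE).
  by rewrite /mono_cliques delete_vertex_compl.
by rewrite big_split leq_add ?sum_num_cliques_delete_vertex.
Qed.

End VertexDeletion.

(** * Lower bounds on the Ramsey multiplicity constant *)

Section RamseyMultiplicity.
Local Open Scope ring_scope.
Local Open Scope classical_set_scope.
Variable R : realType.

Lemma mono_density_homo t :
  {homo (fun n => (min_mono_cliques t n)%:R / 'C(n, t)%:R : R) :
     m n / (m <= n)%N >-> m <= n}.
Proof.
(* For [n < t] the ratio is [0], the inverse of [0] being [0]; otherwise [mul_bin_down] matches the
   averaged deletion inequality. *)
apply/nondecreasing_seqP => n; have [nt|tn] := ltnP n t.
  by rewrite bin_small// invr0 mulr0 divr_ge0.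
have C0 k : (t <= k)%N -> 0 < 'C(k, t)%:R :> R by rewrite ltr0n bin_gt0.
rewrite ler_pdivrMr ?C0// mulrAC ler_pdivlMr ?C0 ?leqW//.
rewrite -!natrM ler_nat -(@leq_pmul2l n.+1)//.
rewrite mulnA [leqRHS]mulnCA [(n.+1 * 'C(n, t))%N](mul_bin_down n.+1 t).
rewrite mulnA [(_ * (_ - _))%N]mulnC leq_mul2r min_mono_cliques_step.
by rewrite orbT.
Qed.

Lemma mono_density_le2 t n :
  (min_mono_cliques t n)%:R / 'C(n, t)%:R <= 2 :> R.
Proof.
have [nt|tn] := ltnP n t; first by rewrite bin_small// invr0 mulr0.
rewrite ler_pdivrMr ?ltr0n ?bin_gt0// -natrM ler_nat mul2n -addnn.
have [E [_ <-]] := min_mono_cliques_ex t n.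
have le (E' : {set {set 'I_n}}) : (num_cliques t E' <= 'C(n, t))%N.
  have := card_draws 'I_n t; rewrite card_ord /num_cliques => <-.
  apply: subset_leq_card.
  by apply/fintype.subsetP => B; rewrite !finset.inE => /andP[].
exact: leq_add.
Qed.

(** As ['C(n, t)] is at most [n ^ t / t!], an eventual bound on the counts bounds the ratios, hence
    their limit, which exists by monotonicity. *)
Lemma ramsey_mult_const_ge t (c : R) : 0 <= c ->
  (\forall n \near \oo, c * n%:R ^+ t / t`!%:R <= (min_mono_cliques t n)%:R) ->
  c <= ramsey_mult_const R t.
Proof.
move=> c0 cn; apply: limr_ge.
  apply: nondecreasing_is_cvgn; first exact: mono_density_homo.
  by exists 2 => _ [n _ <-]; exact: mono_density_le2.
near=> n; have tn : (t <= n)%N by near: n; exact: nbhs_infty_ge.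
rewrite ler_pdivlMr ?ltr0n ?bin_gt0//.
apply: (@le_trans _ _ (c * n%:R ^+ t / t`!%:R)); last by near: n.
rewrite -mulrA ler_wpM2l// ler_pdivlMr ?ltr0n ?fact_gt0//.
rewrite -natrM bin_ffact -natrX ler_nat ffact_prod.
rewrite -[t in leqRHS]card_ord -prod_nat_const.
by apply: leq_prod => i _; exact: leq_subr.
Unshelve. all: by end_near. Qed.

Lemma ramsey_mult_const_ge_of_recursion (M : nat -> nat -> R) :
  (forall i j, 0 < M i j <= 1) ->
  (forall i j, exists p q : R, [/\ 0 < p, 0 < q, p + q < 1,
     M i.+1 j.+1 <= 2^-1 * M i j.+1 * p ^+ (maxn i j).+1 &
     M i.+1 j.+1 <= 2^-1 * M i.+1 j * q ^+ (maxn i j).+1]) ->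
  forall t, M t t <= ramsey_mult_const R t.
Proof.
move=> M01 Mpq t; have /andP[M0 _] := M01 t t.
have [N HN] := ramsey_density M01 Mpq t t.
apply: ramsey_mult_const_ge; first exact: ltW.
near=> n; have [E [_ <-]] := min_mono_cliques_ex t n.
have Nn : (N <= #|(finset.setT : {set 'I_n})|)%N.
  by rewrite cardsT card_ord; near: n; exact: nbhs_infty_ge.
have cov (x y : 'I_n) : x != y ->
    ([set x; y]%SET \in E) || ([set x; y]%SET \in graph_compl E).
  by move=> xy; rewrite finset.inE cards2 xy; case: (_ \in _).
have := HN _ _ _ _ cov Nn.
rewrite cardsT card_ord -!num_cliquesE /mono_cliques natrD.
by case=> H; apply: (le_trans H); rewrite ?lerDl ?lerDr.
Unshelve. all: by end_near. Qed.

End RamseyMultiplicity.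

Local Open Scope classical_set_scope.
Local Open Scope ring_scope.

(** * Derivatives relative to an interval *)

Section WithinDerivative.
Variable R : realType.
Implicit Types (f : R -> R) (x l : R).

Lemma has_deriv_withinP (A : set R) f x l : has_deriv_within A f x l <->
  forall e, 0 < e -> \forall y \near x, y != x -> A y ->
    `| l - (f y - f x) / (y - x) | < e.
Proof.
split => [/cvgrPdist_lt H e e0|H].
  exact: (H e e0).
apply/cvgrPdist_lt => e e0; exact: (H e e0).
Qed.

(** Near [x] the difference quotients are within [1] of [l], so increments of [f] are at most |l| +
    1 times those of the variable. *)
Lemma within_deriv_continuous (A : set R) f :
  (forall x, A x -> exists l, has_deriv_within A f x l) ->
  {within A, continuous f}.
Proof.
move=> df; apply/subspace_continuousP => x Ax.
have [l /has_deriv_withinP/(_ 1 ltr01) fxl] := df x Ax.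
apply/cvgrPdist_lt => e e0.
suff : \forall y \near x, A y -> `|f x - f y| < e by [].
have de : 0 < e / (`|l| + 1) by rewrite divr_gt0// ltr_wpDl.
near=> y => Ay; have [->|yx] := eqVneq y x; first by rewrite subrr normr0.
have yx0 : `|y - x| > 0 by rewrite normr_gt0 subr_eq0.
have /(_ yx Ay) lq : y != x -> A y -> `| l - (f y - f x) / (y - x) | < 1.
  by near: y.
have yd : `|x - y| < e / (`|l| + 1) by near: y; exact: (nbhsx_ballx x _ de).
move: lq; set q := (_ - _) / _ => lq.
have -> : f x - f y = - q * (y - x) by rewrite /q; field; rewrite subr_eq0.
rewrite normrM normrN distrC in yd *.
have : `|q| < `|l| + 1.
  have := lerB_normD l q. have := ler_dist_dist q l. 
  have := ler_norm (`|q| - `|l|); rewrite (distrC q); lra.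
rewrite ltr_pdivlMr ?ltr_wpDl// in yd => ql; apply: le_lt_trans yd.
by rewrite mulrC ler_wpM2l// ltW.
Unshelve. all: by end_near. Qed.

Lemma has_deriv_within_is_derive (a b : R) f x l : x \in `]a, b[ ->
  has_deriv_within `[a, b] f x l -> is_derive x (1 : R) f l.
Proof.
move=> xab /has_deriv_withinP fxl.
have H : h^-1 *: ((f \o shift x) (h *: (1 : R)) - f x) @[h --> (0 : R)^'] --> l.
  apply/cvgrPdist_lt => e e0.
  suff : \forall h \near (0 : R), h != 0 ->
    `|l - h^-1 *: ((f \o shift x) (h *: (1 : R)) - f x)| < e by [].
  have F1 := fxl e e0; have F2 := near_in_itvoo xab.
  have: \forall y \near x, y != x -> `| l - (f y - f x) / (y - x) | < e.
    near=> y => yx; have : y \in `]a, b[ by near: y.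
    move=> yab; have : [set` `[a, b]] y by exact: subset_itv_oo_cc.
    by move: yx; near: y.
  rewrite nbhs0P => {}F1; near=> h => h0; have := near F1 h; rewrite /= scaler1.
  rewrite -subr_eq0 [h + x]addrC addrAC subrr add0r mulrC; apply=> //.
split; first by apply/cvg_ex; exists l.
by apply/cvg_lim.
Unshelve. all: by end_near. Qed.
End WithinDerivative.

(** * Solutions of the differential equation *)

Section ODE.
Variable R : realType.

Definition ode_rhs (x u : R) : R :=
  ln u * (u * (1 - u) / (x - (1 + x) * u)).

Lemma nondecreasing_of_derive (f df : R -> R) :
  {within `[0, 1], continuous f} ->
  (forall x : R, 0 < x < 1 -> is_derive x (1 : R) f (df x)) ->
  (forall x : R, 0 < x < 1 -> 0 <= df x) ->
  forall x z : R, 0 <= x -> x <= z -> z <= 1 -> f x <= f z.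
Proof.
move=> cf fdf df0 x z x0; rewrite le_eqVlt => /predU1P[->//|xz] z1.
have itv c : c \in `]x, z[ -> 0 < c < 1.
  by rewrite in_itv/= => /andP[xc cz]; apply/andP; split; lra.
have [||c /itv c01 fc] := @MVT R f df x z xz.
- by move=> c /itv; exact: fdf.
- apply: continuous_subspaceW cf => c /=; rewrite !in_itv/= => /andP[xc cz].
  by apply/andP; split; lra.
- by rewrite -subr_ge0 fc mulr_ge0 ?df0// subr_ge0 ltW.
Qed.

Lemma within_continuousM (A : set R) (f g : R -> R) :
  {within A, continuous f} -> {within A, continuous g} ->
  {within A, continuous (fun x => f x * g x)}.
Proof.
move=> cf cg x.
exact: (@continuousM R (subspace A) f g x (cf x) (cg x)).
Qed.

Section Solution.
Variable y : R -> R.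
Hypotheses (yode : solves_ode y) (y01 : 0 < y 0 < 1).

Lemma ode_continuous : {within `[0, 1], continuous y}.
Proof.
apply: within_deriv_continuous => x /=; rewrite in_itv/= => x01.
by have [_ _ ?] := yode x01; eexists; eassumption.
Qed.

Lemma ode_pos (x : R) : 0 <= x <= 1 -> 0 < y x.
Proof. by case/yode. Qed.

Lemma ode_is_derive (x : R) : 0 < x < 1 -> is_derive x (1 : R) y (ode_rhs x (y x)).
Proof.
move=> x01; have x01' : 0 <= x <= 1.
  by case/andP: x01 => ? ?; apply/andP; split; lra.
have [_ _] := yode x01'; by apply: has_deriv_within_is_derive; rewrite in_itv.
Qed.

Lemma ode_denom_continuous :
  {within `[0, 1], continuous (fun z : R => (1 + z) * y z - z)}.
Proof.
have cid : {within `[0, 1], continuous (fun z : R => z)}.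
  by apply: continuous_subspaceT => z; exact: cvg_id.
have c1 : {within `[0, 1], continuous (fun z : R => 1 + z)}.
  apply: continuous_subspaceT => z.
  by apply: continuousD => //; exact: cvg_cst.
apply: within_continuousB => // z; apply: continuousM; first exact: c1.
exact: ode_continuous.
Qed.

(** This negated denominator equals [y 0 > 0] at [0] and never vanishes, so the intermediate value
    theorem fixes its sign. *)
Lemma ode_above (x : R) : 0 <= x <= 1 -> 0 < (1 + x) * y x - x.
Proof.
move=> x01; pose g (z : R) := (1 + z) * y z - z.
have cg : {within `[0, 1], continuous g} := ode_denom_continuous.
have g0 : 0 < g 0 by rewrite /g addr0 mul1r subr0; case/andP: y01.
have gn0 (z : R) : 0 <= z <= 1 -> g z != 0.
  by case/yode => _ + _; rewrite /g -oppr_eq0 opprB.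
rewrite ltNge; apply/negP => gx; rewrite -/(g x) in gx.
case/andP: (x01) => x0 x1.
have cgx : {within `[0, x], continuous g}.
  apply: continuous_subspaceW cg => c /=; rewrite !in_itv/= => /andP[xc cz].
  by apply/andP; split; lra.
have [c] : exists2 c, c \in `[0, x] & g c = 0.
  by apply: IVT cgx _ => //; rewrite ge_min le_max gx (ltW g0) orbT.
rewrite in_itv/= => /andP[c0 cx] gc; have := gn0 c.
by rewrite gc eqxx c0 (le_trans cx x1) => /(_ isT).
Qed.

(* [z = 1 - y] solves a linear equation [z' = k z] with [k] bounded below by
   [- K], hence [z ^ 2 * exp (2 K x)] is nondecreasing and [z] cannot vanish. *)
Lemma ode_lt1 (x : R) : 0 <= x <= 1 -> y x < 1.
Proof.
pose k (z : R) := ln (y z) * y z * ((1 + z) * y z - z)^-1.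
have ck : {within `[0, 1], continuous k}.
  have cl : {within `[0, 1], continuous (@ln R \o y)}.
    apply: within_continuous_comp ode_continuous => u.
    rewrite inE /= => -[z]; rewrite in_itv/= => z01 <-.
    by apply: continuous_ln; exact: ode_pos.
  have ci : {within `[0, 1],
      continuous (@GRing.inv R \o (fun z : R => (1 + z) * y z - z))}.
    apply: within_continuous_comp ode_denom_continuous => u.
    rewrite inE /= => -[z]; rewrite in_itv/= => z01 <-.
    by apply: inv_continuous; rewrite gt_eqF// ode_above.
  apply: within_continuousM; last exact: ci.
  by apply: within_continuousM; [exact: cl|exact: ode_continuous].
(* [- K] is the minimum of the continuous [k] on the closed interval. *)
have [K Kk] : exists K, forall z : R, 0 <= z <= 1 -> 0 <= K + k z.
  have [c _ kc] := EVT_min ler01 ck; exists (- k c) => z z01.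
  by rewrite addrC subr_ge0; apply: kc; rewrite in_itv.
pose h (z : R) := (1 - y z) * (1 - y z) * expR (2 * K * z).
have dh (z : R) : 0 < z < 1 -> is_derive z (1 : R) h
    (2 * (K + k z) * (1 - y z) ^+ 2 * expR (2 * K * z)).
  move=> z01; have dy := ode_is_derive z01.
  have dl : is_derive z (1 : R) (fun w : R => 2 * K * w) (2 * K).
    have := is_deriveZ (2 * K) (is_derive_id z (1 : R)).
    by move/is_derive_eq; apply; rewrite /GRing.scale/= mulr1.
  have de := is_derive1_comp (is_derive_expR (2 * K * z)) dl.
  have d1 : is_derive z (1 : R) (fun w : R => 1 - y w) (- ode_rhs z (y z)).
    have := is_deriveB (is_derive_cst (1 : R) z (1 : R)) dy.
    by move/is_derive_eq; apply; rewrite sub0r.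
  apply: is_derive_eq (is_deriveM (is_deriveM d1 d1) de) _.
  have gz : (1 + z) * y z - z != 0.
    by rewrite gt_eqF// ode_above//; case/andP: z01 => ? ?; apply/andP; split; lra.
  rewrite /GRing.scale/= /ode_rhs /k !fctE.
  have -> : (z - (1 + z) * y z)^-1 = - ((1 + z) * y z - z)^-1.
    by rewrite -invrN opprB.
  ring.
have ch : {within `[0, 1], continuous h}.
  have c1 : {within `[0, 1], continuous (fun z => 1 - y z)}.
    apply: within_continuousB ode_continuous.
    by apply: continuous_subspaceT => z; exact: cvg_cst.
  apply: within_continuousM; first exact: within_continuousM.
  apply: continuous_subspaceT => z; apply: continuous_comp.
    by apply: continuousM => //; exact: cvg_cst.
  exact: continuous_expR.
have hpos z : 0 <= z <= 1 -> y z != 1.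
  move=> /andP[z0 z1]; have := nondecreasing_of_derive ch dh _ (lexx 0) z0 z1.
  rewrite /h mulr0 expR0 mulr1 => hz; apply/negP => /eqP yz.
  move: hz; rewrite yz subrr !mul0r => hz.
  have {hz}: (1 - y 0) * (1 - y 0) <= 0.
    apply: hz => w w01; apply: mulr_ge0; last exact: expR_ge0.
    apply: mulr_ge0; last exact: sqr_ge0.
    apply: mulr_ge0 => //.
    by apply: Kk; case/andP: w01 => ? ?; apply/andP; split; lra.
  case/andP: y01 => _ yl1; nra.
move=> /andP[x0 x1]; rewrite ltNge; apply/negP => yx.
have cy : {within `[0, x], continuous y}.
  apply: continuous_subspaceW ode_continuous => c /=.
  by rewrite !in_itv/= => /andP[xc cz]; apply/andP; split; lra.
have [c] : exists2 c, c \in `[0, x] & y c = 1.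
  apply: IVT cy _ => //; case/andP: y01 => _ /ltW yl1.
  by rewrite ge_min yl1 le_max yx orbT.
rewrite in_itv/= => /andP[c0 cx] /eqP; apply/negP; apply: hpos.
by rewrite c0 (le_trans cx x1).
Qed.

(** The logarithm and the denominator are both negative. *)
Lemma ode_rhs_gt0 (x : R) : 0 <= x <= 1 -> 0 < ode_rhs x (y x).
Proof.
move=> x01; have yp := ode_pos x01; have yl := ode_lt1 x01.
have ya := ode_above x01; rewrite /ode_rhs.
rewrite nmulr_rgt0 ?ln_lt0 ?yp// pmulr_rlt0 ?mulr_gt0 ?subr_gt0//.
by rewrite invr_lt0; lra.
Qed.

Lemma ode_nondecreasing (x z : R) : 0 <= x -> x <= z -> z <= 1 -> y x <= y z.
Proof.
apply: (@nondecreasing_of_derive y (fun w => ode_rhs w (y w))).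
- exact: ode_continuous.
- exact: ode_is_derive.
- move=> w /andP[w0 w1]; apply/ltW/ode_rhs_gt0.
  by apply/andP; split; lra.
Qed.

(** The profile [f] of the homogeneous [F]: Euler's identity [2 F = x F_x + y F_y] with the
    prescribed gradient gives this formula. *)
Definition ode_profile (s : R) : R := - 2^-1 * (ln (1 - y s) + s * ln (y s)).

(** By the differential equation the terms containing the derivative of [y] sum to [- ln (y s) / 2];
    differentiating the factor [s] contributes the same amount. *)
Lemma is_derive_ode_profile (s : R) : 0 < s < 1 ->
  is_derive s (1 : R) ode_profile (- ln (y s)).
Proof.
move=> s01; have s01' : 0 <= s <= 1.
  by case/andP: s01 => ? ?; apply/andP; split; lra.
have dy := ode_is_derive s01.
have yp := ode_pos s01'; have yl := ode_lt1 s01'; have ya := ode_above s01'.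
have d1 : is_derive s (1 : R) (fun w : R => 1 - y w) (- ode_rhs s (y s)).
    have := is_deriveB (is_derive_cst (1 : R) s (1 : R)) dy.
  by move/is_derive_eq; apply; rewrite sub0r.
have dl1 : is_derive s (1 : R) (@ln R \o (fun w : R => 1 - y w))
    ((1 - y s)^-1 * - ode_rhs s (y s)).
  by apply: is_derive1_comp; apply: is_derive1_ln; rewrite subr_gt0.
have dl2 : is_derive s (1 : R) (@ln R \o y) ((y s)^-1 * ode_rhs s (y s)).
  by apply: is_derive1_comp; exact: is_derive1_ln.
have dm := is_deriveM (is_derive_id s (1 : R)) dl2.
apply: is_derive_eq (is_deriveZ (- 2^-1) (is_deriveD dl1 dm)) _.
rewrite /GRing.scale/= /ode_rhs.
have n1 : 1 - y s != 0 by rewrite gt_eqF// subr_gt0.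
have n2 : s - (1 + s) * y s != 0 by rewrite lt_eqF//; lra.
by field; rewrite n1 n2 gt_eqF.
Qed.

Lemma ode_profile_continuous : {within `[0, 1], continuous ode_profile}.
Proof.
have cst_within (a : R) : {within `[0, 1], continuous (fun _ : R => a)}.
  by apply: continuous_subspaceT => z; exact: cvg_cst.
have ln_within (g : R -> R) : {within `[0, 1], continuous g} ->
    (forall z : R, 0 <= z <= 1 -> 0 < g z) ->
    {within `[0, 1], continuous (@ln R \o g)}.
  move=> cg g0; apply: within_continuous_comp cg => u.
  rewrite inE /= => -[z]; rewrite in_itv/= => z01 <-.
  by apply: continuous_ln; exact: g0.
apply: within_continuousM; first exact: cst_within.
apply: within_continuousD.
  apply: (ln_within (fun s => 1 - y s)) => [|z z01].
    exact: within_continuousB ode_continuous.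
  by rewrite subr_gt0 ode_lt1.
apply: within_continuousM; last exact: ln_within ode_continuous ode_pos.
by apply: continuous_subspaceT => z; exact: cvg_id.
Qed.

(** Concavity: the slope [- ln (y s)] is nonincreasing because [y] is nondecreasing, so the graph
    lies below its tangents. *)
Lemma ode_profile_tangent (s z : R) : 0 <= s <= 1 -> 0 <= z <= 1 ->
  ode_profile z <= ode_profile s - ln (y s) * (z - s).
Proof.
move=> s01 z01.
have lnS (a b : R) : 0 <= a -> a <= b -> b <= 1 -> ln (y a) <= ln (y b).
  move=> a0 ab b1; rewrite ler_ln ?posrE ?ode_nondecreasing ?ode_pos//.
  - by rewrite a0 (le_trans ab b1).
  - by rewrite b1 (le_trans a0 ab).
have mvt (a b : R) : 0 <= a -> a < b -> b <= 1 -> exists2 c, a < c < b &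
    ode_profile b - ode_profile a = - ln (y c) * (b - a).
  move=> a0 ab b1; have itv c : c \in `]a, b[ -> 0 < c < 1.
    by rewrite in_itv/= => /andP[ac cb]; apply/andP; split; lra.
  have [||c] := @MVT R ode_profile (fun w => - ln (y w)) a b ab.
  - by move=> c /itv; exact: is_derive_ode_profile.
  - apply: continuous_subspaceW ode_profile_continuous => c /=.
    by rewrite !in_itv/= => /andP[ac cb]; apply/andP; split; lra.
  - by rewrite in_itv/= => ? ?; exists c.
case/andP: s01 => s0 s1; case/andP: z01 => z0 z1.
case: (ltgtP s z) => [sz|zs|<-]; last by rewrite subrr mulr0 subr0.
- have [c /andP[sc cz]] := mvt s z s0 sz z1.
  have lc : ln (y s) <= ln (y c) by apply: lnS; lra.
  nra.
- have [c /andP[sc cz]] := mvt z s z0 zs s1.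
  have lc : ln (y c) <= ln (y s) by apply: lnS; lra.
  nra.
Qed.

End Solution.
(** The right-hand side is a product of positive factors: [- ln w] and [1 - w] decrease strictly,
    and [w / ((1 + x) * w - x)] does not increase. *)
Lemma ode_rhs_decreasing (x u v : R) : 0 <= x -> 0 < u -> u < v -> v < 1 ->
  0 < (1 + x) * u - x -> ode_rhs x v < ode_rhs x u.
Proof.
move=> x0 u0 uv v1 gu.
have gv : 0 < (1 + x) * v - x by nra.
have v0 : 0 < v by lra.
have rhsE w : ode_rhs x w = (- ln w) * (1 - w) * (w / ((1 + x) * w - x)).
  rewrite /ode_rhs (_ : (x - (1 + x) * w)^-1 = - ((1 + x) * w - x)^-1); first by ring.
  by rewrite -invrN opprB.
have lu : 0 < - ln u by rewrite oppr_gt0 ln_lt0// u0 (lt_trans uv).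
have lv : 0 < - ln v by rewrite oppr_gt0 ln_lt0// v0.
have luv : - ln v < - ln u by rewrite ltrN2 ltr_ln ?posrE.
have gd : v / ((1 + x) * v - x) <= u / ((1 + x) * u - x).
  by rewrite ler_pdivlMr// mulrAC ler_pdivrMr//; nra.
have gp : 0 < v / ((1 + x) * v - x) by rewrite divr_gt0.
rewrite !rhsE; apply: (@lt_le_trans _ _ (- ln u * (1 - u) * (v / ((1 + x) * v - x)))).
  by rewrite ltr_pM2r//; nra.
by rewrite ler_wpM2l// mulr_ge0 ?(ltW lu)//; lra.
Qed.

(** At a positive maximum [c] of [y1 - y2] the derivative would be negative, the right-hand side
    being decreasing, yet difference quotients from the left are nonnegative. The initial condition
    forces [c > 0], so there is room on the left. *)
Lemma ode_comparison (y1 y2 : R -> R) : solves_ode y1 -> solves_ode y2 ->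
  0 < y1 0 < 1 -> 0 < y2 0 < 1 -> y1 0 <= y2 0 ->
  forall x : R, 0 <= x <= 1 -> y1 x <= y2 x.
Proof.
move=> o1 o2 y10 y20 y12 x x01; pose d z := y1 z - y2 z.
have cd : {within `[0, 1], continuous d}.
  by apply: within_continuousB; exact: ode_continuous.
have [c] := EVT_max ler01 cd; rewrite in_itv/= => c01 dmax.
rewrite -subr_le0; apply: (@le_trans _ _ (d c)).
  by apply: dmax; rewrite in_itv.
rewrite leNgt; apply/negP => dc.
case/andP: (c01) => c0 c1.
have cpos : 0 < c.
  rewrite lt_neqAle c0 andbT; apply/eqP => c0'; move: dc.
  by rewrite -c0' /d subr_gt0 ltNge y12.
have rhs_lt : ode_rhs c (y1 c) < ode_rhs c (y2 c).
  apply: ode_rhs_decreasing => //.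
  - by have [] := o2 _ c01.
  - by rewrite -subr_gt0.
  - exact: ode_lt1.
  - exact: ode_above.
have [_ _ d1] := o1 _ c01; have [_ _ d2] := o2 _ c01.
have /has_deriv_withinP dd : has_deriv_within `[0, 1] d c
    (ode_rhs c (y1 c) - ode_rhs c (y2 c)).
  rewrite /has_deriv_within (_ : (fun z => (d z - d c) / (z - c)) =
    (fun z => (y1 z - y1 c) / (z - c) - (y2 z - y2 c) / (z - c))).
    exact: cvgB.
  by apply/funext => z; rewrite /d; ring.
set l := _ - _ in dd; have l0 : l < 0 by rewrite /l subr_lt0.
have := dd (- l); rewrite oppr_gt0 => /(_ l0) /nbhs_ballP[e /= e0 de].
(* A point to the left of [c] and within [e] of it, cut off at [0] to stay in the interval. *)
pose w := Num.max 0 (c - e / 2).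
have w0 : 0 <= w by rewrite le_max lexx.
have wc : w < c by rewrite gt_max cpos/=; lra.
have we : c - e / 2 <= w by rewrite le_max lexx orbT.
have /de : ball c e w by rewrite /ball/= gtr0_norm; lra.
rewrite lt_eqF// in_itv/= w0 (le_trans (ltW wc) c1) => /(_ isT isT).
have dw : d w <= d c by apply: dmax; rewrite in_itv/= w0 (le_trans (ltW wc) c1).
have : 0 <= (d w - d c) / (w - c).
  by rewrite -mulrNN mulr_ge0 ?oppr_ge0 ?invr_le0 ?subr_le0 ?(ltW wc)//; lra.
set q := _ / _ => q0; rewrite ler0_norm; lra.
Qed.

End ODE.

(** * The limit as [eps] tends to [0] *)

Section Limit.
Variables (R : realType) (tau : R -> R -> R).
Hypothesis tau_ode : forall eps : R, 0 < eps < 1 ->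
  tau eps 0 = eps /\ solves_ode (tau eps).

Lemma tau_init (eps : R) : 0 < eps < 1 -> 0 < tau eps 0 < 1.
Proof. by move=> e01; have [-> _] := tau_ode e01. Qed.

(** At [x = 1] the bound [ode_above] reads [0 < 2 * tau eps 1 - 1]. *)
Lemma tau1_bounds (eps : R) : 0 < eps < 1 -> 2^-1 < tau eps 1 < 1.
Proof.
move=> e01; have [_ so] := tau_ode e01; have ti := tau_init e01.
have i1 : 0 <= (1 : R) <= 1 by rewrite ler01 lexx.
rewrite (ode_lt1 so ti i1) andbT; have := ode_above so ti i1; lra.
Qed.

Lemma tau1_homo :
  {in `]0, 1[ &, {homo (fun eps => tau eps 1) : a b / a <= b}}.
Proof.
move=> a b; rewrite !in_itv/= => a01 b01 ab.
have [ta sa] := tau_ode a01; have [tb sb] := tau_ode b01.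
apply: ode_comparison sa sb _ _ _ _ _; rewrite ?ta ?tb//.
by rewrite ler01 lexx.
Qed.

Lemma tau1_cvg : cvg (tau eps 1 @[eps --> 0^'+]).
Proof.
apply/cvg_ex; eexists; apply: (@nondecreasing_at_right_cvgr R _ 0 (BLeft 1)) => //.
- by rewrite bnd_simp.
- exact: tau1_homo.
- exists 2^-1 => r [e /=]; rewrite in_itv/= => e01 <-.
  by have /andP[/ltW] := tau1_bounds e01.
Qed.

Lemma tau1_lim_bounds : 2^-1 <= lim (tau eps 1 @[eps --> 0^'+]) < 1.
Proof.
have h01 : 0 < (2^-1 : R) < 1 by apply/andP; split; lra.
have e01 : \forall e \near (0 : R)^'+, 0 < e <= 2^-1.
  near do (apply/andP; split); first exact: nbhs_right_gt.
  by apply: nbhs_right_le; case/andP: h01.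
apply/andP; split.
  apply: limr_ge; first exact: tau1_cvg.
  near=> e; have /andP[e0 e1] : 0 < e <= 2^-1 by near: e.
  by apply/ltW; have /andP[] : 2^-1 < tau e 1 < 1 by apply: tau1_bounds; apply/andP; split; lra.
(* Passing to the limit in [tau eps 1 < 1] would lose strictness; comparison with the solution
   started at [2^-1] keeps it. *)
apply: (@le_lt_trans _ _ (tau 2^-1 1)); last by have /andP[] := tau1_bounds h01.
apply: limr_le; first exact: tau1_cvg.
near=> e; have /andP[e0 e1] : 0 < e <= 2^-1 by near: e.
by apply: tau1_homo => //; rewrite in_itv/=; apply/andP; split; lra.
Unshelve. all: by end_near. Qed.

End Limit.

(** * The potential at integer points and its increments *)

Section Potential.
Variables (R : realType) (f P Q : R -> R).
Hypotheses (P_ge0 : forall s : R, 0 <= s <= 1 -> 0 <= P s)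
  (Q_ge0 : forall s : R, 0 <= s <= 1 -> 0 <= Q s)
  (fE : forall s : R, f s = 2^-1 * (P s + s * Q s))
  (f_tangent : forall s z : R, 0 <= s <= 1 -> 0 <= z <= 1 ->
     f z <= f s + Q s * (z - s))
  (PQ1 : forall s : R, 0 <= s <= 1 -> expR (- P s) + expR (- Q s) <= 1).

Definition potential (a b : nat) : R :=
  (maxn a b)%:R ^+ 2 * f ((minn a b)%:R / (maxn a b)%:R).

Lemma potentialC a b : potential a b = potential b a.
Proof. by rewrite /potential maxnC minnC. Qed.

Lemma ratio_itv (a b : nat) : (b <= a)%N -> 0 <= (b%:R / a%:R : R) <= 1.
Proof.
case: a => [|a] ba; first by rewrite invr0 mulr0 lexx ler01.
by rewrite divr_ge0//= ler_pdivrMr ?ltr0n// mul1r ler_nat.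
Qed.

Lemma f_ge0 s : 0 <= s <= 1 -> 0 <= f s.
Proof.
move=> s01; rewrite fE mulr_ge0// addr_ge0 ?P_ge0// mulr_ge0 ?Q_ge0//.
by case/andP: s01.
Qed.

Lemma potential_ge0 a b : 0 <= potential a b.
Proof.
by rewrite mulr_ge0 ?sqr_ge0// f_ge0// ratio_itv//; lia.
Qed.

Lemma potential_le a b : potential a b <= (maxn a b)%:R ^+ 2 * f 1.
Proof.
have i1 : 0 <= (1 : R) <= 1 by rewrite ler01 lexx.
rewrite ler_wpM2l ?sqr_ge0//.
have r01 : 0 <= ((minn a b)%:R / (maxn a b)%:R : R) <= 1.
  by apply: ratio_itv; lia.
apply: (le_trans (f_tangent i1 r01)).
have := Q_ge0 i1; case/andP: r01; nra.
Qed.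

(** The tangent at [s = b / (a + 1)] bounds [f (b / a)]. By [fE] the terms in [Q] then cancel up to
    the nonnegative remainder [f s]. *)
Lemma potential_stepP (a b : nat) : (0 < a)%N -> (b <= a)%N ->
  a%:R * P (b%:R / a.+1%:R) <= potential a.+1 b - potential a b.
Proof.
move=> a0 ba; rewrite /potential (maxn_idPl (leqW ba)) (minn_idPr (leqW ba)).
rewrite (maxn_idPl ba) (minn_idPr ba).
have s01 := ratio_itv (leqW ba); have := f_tangent s01 (ratio_itv ba).
rewrite (fE (b%:R / a.+1%:R)); have := P_ge0 s01; have := Q_ge0 s01.
move: s01 => /andP[s0 s1].
have aR0 : 0 < a%:R :> R by rewrite ltr0n.
have aS0 : 0 < 1 + a%:R :> R by rewrite ltr_pwDl.
rewrite -nat1r in s0 s1 *.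
set s := b%:R / (1 + a%:R) in s0 s1 *; set z := b%:R / a%:R.
have -> : z - s = s / a%:R by rewrite /z /s; field; rewrite !gt_eqF.
set p := P s; set q := Q s; set x := a%:R in aR0 aS0 *.
move=> q0 p0 tan.
have : x ^+ 2 * f z <= x ^+ 2 * (2^-1 * (p + s * q) + q * (s / x)).
  by rewrite ler_wpM2l ?sqr_ge0.
have -> : x ^+ 2 * (2^-1 * (p + s * q) + q * (s / x)) =
    x ^+ 2 * (2^-1 * (p + s * q)) + x * (s * q) by field; rewrite gt_eqF.
have sq0 : 0 <= s * q by rewrite mulr_ge0.
nra.
Qed.

(** The tangent at [(b + 1) / a], read a distance [1 / a] to the left, gives this without
    remainder. *)
Lemma potential_stepQ (a b : nat) : (b < a)%N ->
  a%:R * Q (b.+1%:R / a%:R) <= potential a b.+1 - potential a b.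
Proof.
move=> ba; have ba' := ltnW ba; rewrite /potential.
rewrite (maxn_idPl ba) (minn_idPr ba) (maxn_idPl ba') (minn_idPr ba').
have aR0 : 0 < a%:R :> R by rewrite ltr0n (leq_ltn_trans _ ba).
have := f_tangent (ratio_itv ba) (ratio_itv ba').
set q := Q _; set u := f _; set v := f _; set x := a%:R in aR0 *.
have -> : b%:R / x - b.+1%:R / x = - x^-1 :> R.
  by rewrite -nat1r; field; rewrite gt_eqF.
move=> vu; have : x ^+ 2 * u <= x ^+ 2 * (v + q * - x^-1).
  by rewrite ler_wpM2l ?sqr_ge0.
have -> : x ^+ 2 * (v + q * - x^-1) = x ^+ 2 * v - x * q.
  by field; rewrite gt_eqF.
lra.
Qed.

(** The partial derivative of the potential in its first argument, divided by the larger argument.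
    The value [0] at the kink is a safe lower bound; its cost is the extra unit in [slope_exp]. *)
Definition slope (a b : nat) : R :=
  if (b < a)%N then P (b%:R / a%:R)
  else if (a < b)%N then Q (a%:R / b%:R) else 0.

Lemma slope_ge0 a b : 0 <= slope a b.
Proof.
rewrite /slope; case: ltngtP => // [ba|ab].
- by rewrite P_ge0// ratio_itv// ltnW.
- by rewrite Q_ge0// ratio_itv// ltnW.
Qed.

Lemma slope_exp a b :
  expR (- slope a b) + expR (- slope b a) <= 1 + (a == b)%:R.
Proof.
rewrite /slope; case: ltngtP => [ba|ab|_].
- by rewrite addr0 PQ1// ratio_itv// ltnW.
- by rewrite addr0 addrC PQ1// ratio_itv// ltnW.
- by rewrite oppr0 expR0.
Qed.

(** The strict inequality on [m] absorbs the coefficient [a], rather than [a.+1], of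
    [potential_stepP]. *)
Lemma potential_step (a b m : nat) : (0 < a)%N -> (m < maxn a.+1 b)%N ->
  m%:R * slope a.+1 b <= potential a.+1 b - potential a b.
Proof.
move=> a0 mab.
have weak x r : (m <= x)%N -> x%:R * slope a.+1 b <= r ->
    m%:R * slope a.+1 b <= r.
  by move=> mx; apply: le_trans; rewrite ler_wpM2r ?slope_ge0 ?ler_nat.
case: (ltngtP b a.+1) => [ba|ab|->].
- apply: (weak a); first by move: mab; rewrite (maxn_idPl (ltnW ba)).
  by rewrite /slope ba potential_stepP.
- apply: (weak b); first by move: mab; rewrite (maxn_idPr (ltnW ab)) => /ltnW.
  rewrite /slope ltnNge (ltnW ab)/= ab potentialC (potentialC a).
  exact/potential_stepQ/ltnW.
- rewrite /slope ltnn mulr0 (potentialC a).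
  apply: le_trans (potential_stepQ (ltnSn a)).
  by rewrite mulr_ge0// Q_ge0// ratio_itv.
Qed.

(** Jensen's inequality, by averaging the tangent bound [expR (u k) >= expR c * (1 + (u k - c))] at
    the mean [c]. *)
Lemma expR_avg_le (n : nat) (u : 'I_n.+1 -> R) :
  expR (n.+1%:R^-1 * \sum_k u k) <= n.+1%:R^-1 * \sum_k expR (u k).
Proof.
set c := _ * \sum_k u k.
have n0 : n.+1%:R != 0 :> R by rewrite pnatr_eq0.
have -> : expR c = n.+1%:R^-1 * \sum_k (expR c * (1 + (u k - c))).
  rewrite -mulr_sumr big_split/= sumrB !sumr_const card_ord -[c *+ _]mulr_natr.
  by rewrite {3}/c; field.
rewrite ler_wpM2l ?invr_ge0//; apply: ler_sum => k _.
have -> : expR (u k) = expR c * expR (u k - c) by rewrite -expRD addrC subrK.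
by rewrite ler_wpM2l ?expR_ge0 ?expR_ge1Dx.
Qed.

(** * Smoothing across the diagonal *)

Section Smoothing.
Variables (W : nat) (delta : R).
Hypotheses (delta_gt0 : 0 < delta) (W_delta : W.+1%:R^-1 < delta).

(* Averaging over an antidiagonal window removes the kink of [potential] along
   the diagonal, where its two backward slopes are both too small. *)
Definition smooth_potential (i j : nat) : R :=
  W.+1%:R^-1 * (\sum_(k < W.+1) potential (i.+1 + k) (j.+1 + (W - k)))
  + delta * (i + j)%:R ^+ 2.

Lemma smooth_potentialC i j : smooth_potential i j = smooth_potential j i.
Proof.
rewrite /smooth_potential addnC; congr (_ * _ + _).
rewrite (reindex_inj rev_ord_inj)/=; apply: eq_bigr => k _.
by rewrite potentialC subSS subKn// -ltnS.
Qed.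

Definition avg_slope (i j : nat) : R :=
  W.+1%:R^-1 * \sum_(k < W.+1) slope (i.+1 + k) (j.+1 + (W - k)).

(** The shift by one in both arguments of [smooth_potential] meets the positivity and strictness
    conditions of [potential_step]; the quadratic term supplies the summand [delta]. *)
Lemma smooth_potential_step i j :
  (maxn i j).+1%:R * (delta + avg_slope i.+1 j.+1) <=
  smooth_potential i.+1 j.+1 - smooth_potential i j.+1.
Proof.
set m := (maxn i j).+1.
have S : m%:R * avg_slope i.+1 j.+1 <= W.+1%:R^-1 *
    (\sum_(k < W.+1) potential (i.+2 + k) (j.+2 + (W - k))) -
    W.+1%:R^-1 * (\sum_(k < W.+1) potential (i.+1 + k) (j.+2 + (W - k))).
  rewrite -mulrBr -sumrB /avg_slope mulrCA ler_wpM2l ?invr_ge0// mulr_sumr.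
  apply: ler_sum => k _; rewrite [(i.+2 + k)%N]addSn; apply: potential_step => //.
  rewrite /m; lia.
have D : m%:R * delta <= delta * (i.+1 + j.+1)%:R ^+ 2 - delta * (i + j.+1)%:R ^+ 2.
  rewrite -mulrBr mulrC ler_wpM2l ?(ltW delta_gt0)// -!natrX -natrB ?ler_nat.
    by rewrite /m; nia.
  by rewrite leq_sqr; lia.
by rewrite mulrDr addrC /smooth_potential opprD addrACA; exact: lerD.
Qed.

(** An antidiagonal window meets the diagonal at most once, so after Jensen the excess over [1] is
    at most [W.+1%:R^-1 < delta], and the factor [expR (- delta)] removes it. *)
Lemma avg_slope_exp i j :
  expR (- (delta + avg_slope i j)) + expR (- (delta + avg_slope j i)) < 1.
Proof.
have n0 : 0 < W.+1%:R :> R by rewrite ltr0n.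
have -> : avg_slope j i =
    W.+1%:R^-1 * \sum_(k < W.+1) slope (j.+1 + (W - k)) (i.+1 + k).
  rewrite /avg_slope (reindex_inj rev_ord_inj)/=; congr (_ * _).
  by apply: eq_bigr => k _; rewrite subSS subKn// -ltnS.
have jensen (u : 'I_W.+1 -> R) : expR (- (W.+1%:R^-1 * \sum_k u k)) <=
    W.+1%:R^-1 * \sum_k expR (- u k).
  by apply: le_trans (expR_avg_le _); rewrite sumrN mulrN.
rewrite !opprD !expRD -mulrDr expRN mulrC ltr_pdivrMr ?expR_gt0// mul1r.
apply: (le_lt_trans (lerD (jensen _) (jensen _))).
rewrite -mulrDr -big_split/=.
apply: (@le_lt_trans _ _ (W.+1%:R^-1 * \sum_(k < W.+1)
    (1 + ((i.+1 + k)%N == (j.+1 + (W - k))%N)%:R))).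
  by rewrite ler_wpM2l ?invr_ge0//; apply: ler_sum => k _; exact: slope_exp.
apply: (@le_lt_trans _ _ (W.+1%:R^-1 * (W.+1%:R + 1))).
  rewrite ler_wpM2l ?invr_ge0// big_split/= sumr_const card_ord lerD2l.
  rewrite -natr_sum (ler_nat _ _ 1).
  case: (pickP (fun k : 'I_W.+1 => (i.+1 + k == j.+1 + (W - k))%N)) => [k kE|no].
    rewrite (bigD1 k)//= big1 ?addn0 ?leq_b1// => l lk.
    apply/eqP; rewrite eqb0; apply: contra lk => /eqP lE; apply/eqP/val_inj => /=.
    move/eqP: kE; have := ltn_ord k; have := ltn_ord l; lia.
  by rewrite big1// => k _; have := no k => /= ->.
rewrite mulrDr mulVf ?gt_eqF// mulr1.
by apply: lt_le_trans (expR_ge1Dx delta); rewrite ltrD2l.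
Qed.

Lemma smooth_potential_ge0 i j : 0 <= smooth_potential i j.
Proof.
rewrite addr_ge0// mulr_ge0 ?invr_ge0 ?sqr_ge0 ?(ltW delta_gt0)//.
by apply: sumr_ge0 => k _; exact: potential_ge0.
Qed.

Lemma smooth_potential_diag t :
  smooth_potential t t <= (t + W.+1)%:R ^+ 2 * f 1 + 4 * delta * t%:R ^+ 2.
Proof.
have i1 : 0 <= (1 : R) <= 1 by rewrite ler01 lexx.
apply: lerD; last by rewrite natrD; lra.
rewrite mulrC ler_pdivrMr ?ltr0n// mulr_natr -[X in _ *+ X]card_ord -sumr_const.
apply: ler_sum => k _; apply: (le_trans (potential_le _ _)).
rewrite ler_wpM2r ?f_ge0// -!natrX ler_nat leq_sqr.
have := ltn_ord k; lia.
Qed.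

Lemma ramsey_mult_const_ge_potential t :
  expR (- ((t + W.+1)%:R ^+ 2 * f 1 + 4 * delta * t%:R ^+ 2 + 2 * t%:R))
  <= ramsey_mult_const R t.
Proof.
(* The extra [i + j] in the exponent pays for the factor [2^-1] at each step, as
   [expR (- 1) <= 2^-1]. *)
pose M (i j : nat) := expR (- (smooth_potential i j + (i + j)%:R)).
apply: (@le_trans _ _ (M t t)).
  by rewrite ler_expR lerN2 natrD; have := smooth_potential_diag t; lra.
have e2 : expR (- 1) <= 2^-1 :> R.
  rewrite expRN lef_pV2 ?posrE ?expR_gt0//.
  by have := expR_ge1Dx (1 : R); lra.
have step (i j m : nat) x z (s : R) : m%:R * s <= x - z ->
    expR (- (x + (i + j).+1%:R)) <=
    2^-1 * expR (- (z + (i + j)%:R)) * expR (- s) ^+ m.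
  move=> xz; rewrite -expRM_natl mulrAC -mulrA -expRD.
  apply: le_trans (ler_wpM2r (expR_ge0 _) e2).
  by rewrite -expRD ler_expR -nat1r; lra.
apply: ramsey_mult_const_ge_of_recursion => [i j|i j].
  rewrite expR_gt0 -[leRHS]expR0 ler_expR oppr_le0 addr_ge0//.
  exact: smooth_potential_ge0.
exists (expR (- (delta + avg_slope i.+1 j.+1))).
exists (expR (- (delta + avg_slope j.+1 i.+1))).
split; rewrite ?expR_gt0 ?avg_slope_exp//.
- by rewrite /M addSn; apply: step; exact: smooth_potential_step.
- rewrite /M addnS; apply: step; rewrite maxnC smooth_potentialC.
  by rewrite (smooth_potentialC i.+1); exact: smooth_potential_step.
Qed.

End Smoothing.
End Potential.

(** At [t = 0] the bound of the theorem is [1] whatever the error term, so this case is settled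
    apart, by the empty clique. *)
Lemma ramsey_mult_const0_ge1 (R : realType) : 1 <= ramsey_mult_const R 0.
Proof.
apply: ramsey_mult_const_ge => //; apply: nearW => n.
have [E [_ <-]] := min_mono_cliques_ex 0 n.
rewrite expr0 fact0 divr1 mulr1 (ler_nat _ 1) /mono_cliques.
by rewrite !num_cliquesE !cliques_in0.
Qed.

(** * Asymptotics of the logarithm of the constant *)

Section Asymptotics.
Variables (R : realType) (tau : R -> R -> R).
Hypothesis tau_ode : forall eps : R, 0 < eps < 1 ->
  tau eps 0 = eps /\ solves_ode (tau eps).

(** At [u = tau eps 1] this is [ode_profile] at [1]; at [u = L] it is the logarithm of [C]. *)
Definition log_rate (u : R) : R := - 2^-1 * (ln (1 - u) + ln u).

Lemma log_rate_gt0 u : 0 < u < 1 -> 0 < log_rate u.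
Proof.
move=> /andP[u0 u1]; have l1 : ln u < 0 by rewrite ln_lt0// u0.
have l2 : ln (1 - u) < 0 by rewrite ln_lt0//; apply/andP; split; lra.
by rewrite /log_rate; lra.
Qed.

Lemma ramsey_mult_const_ge_ode (eps delta : R) : 0 < eps < 1 -> 0 < delta ->
  exists K : nat, forall t : nat,
    expR (- ((t + K)%:R ^+ 2 * log_rate (tau eps 1)
             + 4 * delta * t%:R ^+ 2 + 2 * t%:R)) <= ramsey_mult_const R t.
Proof.
move=> e01 d0; have [_ so] := tau_ode e01; have ti := tau_init tau_ode e01.
set y := tau eps in so ti *.
have pos s : 0 <= s <= 1 -> 0 < y s by exact: ode_pos.
have lt1 s : 0 <= s <= 1 -> y s < 1 by exact: ode_lt1.
(* [K] is the window length [W.+1], taken above [delta^-1]. *)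
exists (Num.truncn delta^-1).+2 => t.
have -> : log_rate (y 1) = ode_profile y 1 by rewrite /ode_profile mul1r.
apply: (@ramsey_mult_const_ge_potential R (ode_profile y)
  (fun s => - ln (1 - y s)) (fun s => - ln (y s))) => //.
- move=> s s01; rewrite oppr_ge0 ln_le0//.
  by have := pos s s01; lra.
- by move=> s s01; rewrite oppr_ge0 ln_le0// ltW// lt1.
- by move=> s; rewrite /ode_profile; ring.
- by move=> s z s01 z01; have := ode_profile_tangent so ti s01 z01; lra.
(* The gradient condition holds with equality: [(1 - y s) + y s = 1]. *)
- move=> s s01; rewrite !opprK !lnK ?posrE ?subr_gt0 ?pos ?lt1//; lra.
- rewrite invf_plt ?posrE//; apply: (lt_trans (truncnS_gt delta^-1)).
  by rewrite ltr_nat.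
Qed.

Let L : R := lim (tau eps 1 @[eps --> 0^'+]).

Lemma L_itv : 0 < L < 1.
Proof.
by have /andP[L0 ->] := tau1_lim_bounds tau_ode; rewrite (lt_le_trans _ L0).
Qed.

Lemma log_rate_cvg : log_rate (tau eps 1) @[eps --> 0^'+] --> log_rate L.
Proof.
have /andP[L0 L1] := L_itv.
have cL : tau eps 1 @[eps --> 0^'+] --> L by exact: (tau1_cvg tau_ode).
apply: cvgM; first exact: cvg_cst.
apply: cvgD; apply: continuous_cvg => //.
- by apply: continuous_ln; rewrite subr_gt0.
- by apply: cvgB => //; exact: cvg_cst.
- by apply: continuous_ln.
Qed.

Lemma ramsey_mult_const_gt0 t : 0 < ramsey_mult_const R t.
Proof.
have h01 : 0 < (2^-1 : R) < 1 by apply/andP; split; lra.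
have [K /(_ t)] := ramsey_mult_const_ge_ode h01 ltr01.
by apply: lt_le_trans; exact: expR_gt0.
Qed.

Lemma ln_ramsey_mult_const_ge (eta : R) : 0 < eta ->
  \forall t \near \oo,
    - ln (ramsey_mult_const R t) <= (1 + eta) * log_rate L * t%:R ^+ 2.
Proof.
move=> eta0; have l0 := log_rate_gt0 L_itv; set l := log_rate L in l0 *.
have etal0 : 0 < eta * l by exact: mulr_gt0.
(* The allowance [eta * l] is split: a quarter for the choice of [eps], a quarter for [4 * delta]
   with [delta = eta * l / 16], and half for the terms of lower order. *)
have el0 : 0 < eta * l / 4 by lra.
have [eps [e01 le]] : exists eps : R, 0 < eps < 1 /\
    log_rate (tau eps 1) <= l + eta * l / 4.
  have /cvgrPdist_le/(_ _ el0) H := log_rate_cvg.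
  near (0 : R)^'+ => eps; exists eps; split.
    by near: eps; near do (apply/andP; split); [exact: nbhs_right_gt|exact: nbhs_right_lt].
  have : `|l - log_rate (tau eps 1)| <= eta * l / 4 by near: eps.
  by rewrite ler_norml => /andP[]; lra.
have d0 : 0 < eta * l / 16 by lra.
have [K HK] := ramsey_mult_const_ge_ode e01 d0.
have f0 : 0 < log_rate (tau eps 1).
  apply: log_rate_gt0; have /andP[h ->] := tau1_bounds tau_ode e01.
  by rewrite (lt_trans _ h).
set f := log_rate _ in le f0 HK.
(* Beyond this threshold [2 * K * f * t + K ^ 2 * f + 2 * t] is at most [eta * l / 2 * t ^ 2]. *)
pose B := (2 * K%:R * f + K%:R ^+ 2 * f + 2) / (eta * l / 2).
near=> t; have t1 : 1 <= t%:R :> R.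
  by rewrite ler1n; near: t; exact: nbhs_infty_gt.
have tB : B <= t%:R by near: t; exact: nbhs_infty_ger.
have c0 := ramsey_mult_const_gt0 t.
have : - ln (ramsey_mult_const R t) <= (t + K)%:R ^+ 2 * f
             + 4 * (eta * l / 16) * t%:R ^+ 2 + 2 * t%:R.
  by rewrite lerNl -ler_expR lnK// posrE.
move/le_trans; apply; rewrite natrD.
move: tB; rewrite /B ler_pdivrMr; last by lra.
move=> tB.
set x : R := t%:R in t1 tB *; set k : R := K%:R in tB *.
have k0 : 0 <= k by rewrite ler0n.
have h1 : x * (2 * k * f + k ^+ 2 * f + 2) <= x * (x * (eta * l / 2)).
  by rewrite ler_wpM2l//; lra.
have h2 : k ^+ 2 * f <= x * (k ^+ 2 * f).
  by rewrite ler_peMl// mulr_ge0 ?sqr_ge0 ?ltW.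
have h3 : x ^+ 2 * f <= x ^+ 2 * (l + eta * l / 4).
  by rewrite ler_wpM2l ?sqr_ge0.
lra.
Unshelve. all: by end_near. Qed.

End Asymptotics.

Theorem theorem1 (R : realType) (tau : R -> R -> R)
  (tau_ode : forall eps : R, 0 < eps < 1 ->
     tau eps 0 = eps /\ solves_ode (tau eps)) :
  let L : R := lim (tau eps 1 @[eps --> 0^'+]) in
  let C : R := (L * (1 - L)) `^ (- 2^-1) in
  [/\ cvg (tau eps 1 @[eps --> 0^'+]),
      0 < L < 1 &
      exists o : nat -> R,
        o t @[t --> \oo] --> (0 : R) /\
        forall t : nat,
          C `^ (- ((1 + o t) * t%:R ^+ 2)) <= ramsey_mult_const R t].
Proof.
move=> L C; have L01 : 0 < L < 1 := L_itv tau_ode.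
split => //; first exact: (tau1_cvg tau_ode).
have l0 := log_rate_gt0 L01; have /andP[L0 L1] := L01.
have C0 : 0 < C by rewrite powR_gt0// mulr_gt0// subr_gt0.
have lnC : ln C = log_rate L.
  by rewrite /C ln_powR lnM ?posrE ?subr_gt0// [ln L + _]addrC.
have lt0 (t : nat) : (0 < t)%N -> 0 < log_rate L * t%:R ^+ 2.
  by move=> t0; apply: mulr_gt0 => //; rewrite exprn_gt0// ltr0n.
(* The relative excess of the true exponent over [log_rate L * t ^ 2], cut off at [0] so that
   convergence needs only an upper bound. The junk quotient at [t = 0] is harmless, since it is
   multiplied by [t ^ 2]. *)
pose o (t : nat) : R :=
  Num.max 0 (- ln (ramsey_mult_const R t) / (log_rate L * t%:R ^+ 2) - 1).
exists o; split.
- apply/cvgrPdist_le => eta eta0.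
  have H := ln_ramsey_mult_const_ge tau_ode eta0.
  near=> t; have t0 : (0 < t)%N by near: t; exact: nbhs_infty_gt.
  have o0 : 0 <= o t by rewrite /o le_max lexx.
  rewrite sub0r normrN ger0_norm// /o ge_max ltW//=.
  rewrite lerBlDr ler_pdivrMr; last by apply: lt0.
  by rewrite mulrA [eta + 1]addrC; near: t.
- move=> t; have c0 := ramsey_mult_const_gt0 tau_ode t.
  case: t c0 => [|t] c0.
    by rewrite expr0n/= mulr0 oppr0 powRr0 ramsey_mult_const0_ge1.
  move: C C0 lnC => {}C C0 lnC; rewrite /powR (gt_eqF C0) lnC.
  rewrite -[leRHS]lnK ?posrE// ler_expR mulNr lerNl.
  rewrite -mulrA [_ ^+ 2 * _]mulrC -ler_pdivrMr; last exact: lt0.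
  by rewrite -lerBlDl /o le_max lexx orbT.
Unshelve. all: by end_near. Qed.
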